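(* Let $T>0$, $\omega(x)=(1-x)^{-1}$ on $I=(-1,1)$, and let $(u_N^k)_{0\le k\le n_T}\subset V_N$ be the fully discrete Legendre--Petrov--Galerkin approximation of the KdVB problem with coefficients $\alpha,\beta$, source $f$ and initial datum $u_0$ (all defined in the context). (i) Let $\ell\ge 1$ and assume $\beta(t)\ge 0$ and $\alpha(t)\ge \frac{1}{3\ell}$ for all $0\le t\le T$. Then for all $0<n\le n_T$, $$ \begin{aligned} &\|u_N^n\|_{\omega}^2+\Delta t\sum_{k=0}^{n-1}(3\ell\alpha(t_k)-1)\|\partial_x u_N^{k+\frac12}\|^2+\Delta t\sum_{k=0}^{n-1}\alpha(t_k)\,|\partial_x u_N^{k+\frac12}(-1)|^2\\ &\qquad+\Delta t\sum_{k=0}^{n-1}\beta(t_k)\Bigl(\|\partial_x u_N^{k+\frac12}\|_{\omega}^2-\|u_N^{k+\frac12}\|_{\omega^{-3,0}}^2\Bigr) \le 8\ell\|u_N^0\|_{\omega}^2+8\,\Delta t\,\ell^2\sum_{k=0}^{n-1}\|f^{k+\frac12}\|_{H^{-1}(I)}^2 . \end{aligned} $$ (ii) Assume $\beta(t)>0$ and $\alpha(t)>0$ for $t\in[0,T]$. Then for all $0<n\le n_T$, $$ \begin{aligned} &\|u_N^n\|_{\omega}^2+\Delta t\sum_{k=0}^{n-1}\alpha(t_k)\|\partial_x u_N^{k+\frac12}\|^2+\Delta t\sum_{k=0}^{n-1}\alpha(t_k)\,|\partial_x u_N^{k+\frac12}(-1)|^2\\ &\qquad+\Delta t\sum_{k=0}^{n-1}\beta(t_k)\Bigl(\|\partial_x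 u_N^{k+\frac12}\|_{\omega}^2-\|u_N^{k+\frac12}\|_{\omega^{-3,0}}^2\Bigr) \le 4\|u_N^0\|_{\omega}^2+4\,\Delta t\sum_{k=0}^{n-1}\frac{1}{\alpha(t_k)}\|f^{k+\frac12}\|_{H^{-1}(I)}^2 . \end{aligned} $$
   Context: Let $I=(-1,1)$. For real $a,b$ put $\omega^{a,b}(x)=(1-x)^a(1+x)^b$ on $I$; $(\cdot,\cdot)_{\omega^{a,b}}$ and $\|\cdot\|_{\omega^{a,b}}$ are the inner product and norm of $L^2_{\omega^{a,b}}(I)$ (the $L^2$ space with weight $\omega^{a,b}$); without subscript they denote the unweighted $L^2(I)$ inner product and norm. Here $\omega=\omega^{-1,0}$, and $\omega^{-3,0}(x)=(1-x)^{-3}$. The norm of $H^{-1}(I)$ is $\|g\|_{H^{-1}(I)}=\sup_{0\neq v\in H_0^1(I)}\frac{|(g,v)|}{\|\partial_x v\|}$. The KdVB problem is $$\partial_t u+\alpha(t)\partial_x^3u-\beta(t)\partial_x^2u=f(x,t)\ \text{in } I\times(0,T),\quad u(-1,t)=u(1,t)=\partial_xu(1,t)=0,\quad u(\cdot,0)=u_0 .$$ Let $N\ge 3$, let $\mathbb P_N(I)$ be the polynomials of degree at most $N$ on $I$, $H_0^{2,1}(I)=\{v\in H^2(I)\cap H_0^1(I):\partial_xv(1)=0\}$, $V_N=\mathbb P_N(I)\cap H_0^{2,1}(I)$, $W_N=\mathbb P_N(I)\cap H_0^1(I)$. Let $\Delta t>0$ be the time step, $t_k=k\Delta t$ for $k=0,\dots,n_T$,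 with $n_T\Delta t=T$. Write $v^k=v(\cdot,t_k)$ and, for any sequence, $v^{k+\frac12}=\frac12(v^{k+1}+v^k)$. The fully discrete Legendre--Petrov--Galerkin (LPG) approximation is the sequence $u_N^k\in V_N$, $0\le k\le n_T$, satisfying for all $v\in W_{N-1}$: $(u_N^0,v)=(u_0,v)$ and, for $k=0,\dots,n_T-1$, $$(\Delta t)^{-1}(u_N^{k+1}-u_N^{k},v)+\alpha(t_k)(\partial_x^3u_N^{k+\frac12},v)-\beta(t_k)(\partial_x^2u_N^{k+\frac12},v)=(f^{k+\frac12},v).$$ *)

(* Defs.v *)
From HB Require Import structures.
From mathcomp Require Export all_boot all_order all_algebra.
From mathcomp Require Export all_classical all_reals all_analysis.
Export Order.TTheory GRing.Theory Num.Theory numFieldNormedType.Exports.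

Set Implicit Arguments.
Unset Strict Implicit.
Unset Printing Implicit Defensive.

Local Open Scope classical_set_scope.
Local Open Scope ring_scope.

Section Spaces.
Context {R : realType}.
Implicit Types (u v g phi w : R -> R).

Definition itvI : set R := `]-1, 1[.

Definition jacobi (a b x : R) : R := (1 - x) `^ a * (1 + x) `^ b.

Definition wip w u v : R :=
  Rintegral lebesgue_measure itvI (fun x => u x * v x * w x).

Definition wnorm w u : R := Num.sqrt (wip w u u).

Definition ip u v : R := wip (cst 1) u v.
Definition norm2 u : R := wnorm (cst 1) u.

Definition inL2 u : Prop :=
  measurable_fun itvI u /\
  lebesgue_measure.-integrable itvI (EFin \o (fun x => u x ^+ 2)).

Definition test_fun phi : Prop :=
  (forall (n : nat) (x : R), derivable (derive1n n phi) x 1) /\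
  exists a b : R, [/\ -1 < a, b < 1 &
                      forall x, x \notin `[a, b] -> phi x = 0].

Definition weak_derivative v g : Prop :=
  forall phi, test_fun phi -> ip v (derive1 phi) = - ip g phi.

Definition inH1 v : Prop :=
  inL2 v /\ exists2 g, inL2 g & weak_derivative v g.

Definition inH2 v : Prop :=
  inL2 v /\ exists g h,
    [/\ inL2 g, inL2 h, weak_derivative v g & weak_derivative g h].

(* An element of H^1_0 is given by its representative that is continuous on
   [-1, 1], so that the boundary values make sense pointwise. *)
Definition inH10 v : Prop :=
  [/\ inH1 v, {within `[-1, 1], continuous v}, v (-1) = 0 & v 1 = 0].

(* The continuous representative of an H^2 function is C^1 up to the boundary:
   its derivative at 1 is the one-sided one. *)
Definition inH210 v : Prop :=
  [/\ inH2 v, inH10 v & (v x - v 1) / (x - 1) @[x --> 1^'-] --> (0 : R)].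

(* The pairing of g with every element of H^1_0 is an absolutely convergent
   integral; this holds in particular when g is in L^2. *)
Definition pairs_with_H10 g : Prop :=
  forall v, inH10 v ->
    lebesgue_measure.-integrable itvI (EFin \o (fun x => g x * v x)).

(* The weak derivative dv is unique up to a null set, so the quotient depends
   on v only.  The supremum is taken in the extended reals. *)
Definition Hm1_norm g : \bar R :=
  ereal_sup [set e : \bar R | exists v dv,
    [/\ inH10 v, exists2 x, itvI x & v x != 0,
        inL2 dv /\ weak_derivative v dv &
        e = (`|ip g v| / norm2 dv)%:E]].

Definition PN (N : nat) (p : {poly R}) : Prop := (size p <= N.+1)%N.

Definition VN (N : nat) (p : {poly R}) : Prop := PN N p /\ inH210 (horner p).

Definition WN (N : nat) (p : {poly R}) : Prop := PN N p /\ inH10 (horner p).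

Definition tk (dt : R) (k : nat) : R := k%:R * dt.

Definition half (X : lmodType R) (s : nat -> X) (k : nat) : X :=
  2^-1 *: (s k.+1 + s k).

Definition at_step (f : R -> R -> R) (dt : R) (k : nat) : R -> R :=
  fun x => f x (tk dt k).

Definition fhalf (f : R -> R -> R) (dt : R) (k : nat) : R -> R :=
  half (at_step f dt) k.

(* Only the terms u 0, ..., u nT of the sequence are meaningful. *)
Definition LPG (N nT : nat) (dt : R) (alpha beta : R -> R)
    (f : R -> R -> R) (u0 : R -> R) (u : nat -> {poly R}) : Prop :=
  [/\ forall k, (k <= nT)%N -> VN N (u k),
      forall v : {poly R}, WN N.-1 v -> ip (horner (u 0%N)) (horner v) = ip u0 (horner v) &
      forall k, (k < nT)%N -> forall v : {poly R}, WN N.-1 v ->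
        dt^-1 * ip (horner (u k.+1 - u k)) (horner v)
        + alpha (tk dt k) * ip (horner (half u k)^`(3)) (horner v)
        - beta (tk dt k) * ip (horner (half u k)^`(2)) (horner v)
        = ip (fhalf f dt k) (horner v)].

End Spaces.

(* Main.v *)
(* Test the scheme with v = p / (1 - x), where p = u^{k+1/2}; since p vanishes at
   -1 and to second order at 1, v lies in W_{N-1}.  With p = (1 - x) v,
   integrations by parts give
     (p''', v) = 3/2 ||v'||^2 + p'(-1)^2 / 4,
     -(p'', v) = int (1 - x) v'^2 = ||p'||_omega^2 - ||p||_{omega^{-3,0}}^2 >= 0,
     ||p'||^2  = int (1 - x)^2 v'^2 <= 4 ||v'||^2,
   and the time difference telescopes to that of ||u^k||_omega^2 / 2.  The source
   is bounded by ||f||_{H^{-1}} ||v'||, and Young's inequality absorbs ||v'||. *)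
From HB Require Import structures.
Require Import Defs.
From mathcomp Require Import measurable_realfun ring lra.

Set Implicit Arguments.
Unset Strict Implicit.
Unset Printing Implicit Defensive.

Local Open Scope classical_set_scope.
Local Open Scope ring_scope.

(** * Integration of polynomials over the open interval *)

Section PolynomialIntegrals.
Context {R : realType}.
Implicit Types (p q v s : {poly R}) (g : R -> R).

Local Notation mu := (@lebesgue_measure R).

Lemma continuous_integrable_itvI g : {within `[-1, 1], continuous g} ->
  mu.-integrable itvI (EFin \o g).
Proof.
move=> cg; apply: (@integrableS _ _ _ mu `[-1, 1]%classic) => //.
- exact: measurable_itv.
- by move=> x; exact: subset_itv_oo_cc.
apply: continuous_compact_integrable => //; exact: segment_compact.
Qed.

Lemma continuous_horner_within p (A : set R) : {within A, continuous (horner p)}.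
Proof. by apply: continuous_subspaceT; exact: continuous_horner. Qed.

Lemma integrable_horner p : mu.-integrable itvI (EFin \o horner p).
Proof. exact/continuous_integrable_itvI/continuous_horner_within. Qed.

Lemma derivable_oo_LRcontinuous_horner p (a b : R) :
  derivable_oo_LRcontinuous (horner p) a b.
Proof.
split=> [x _||]; first exact: derivable_horner.
- by apply: cvg_at_right_filter; exact: continuous_horner.
- by apply: cvg_at_left_filter; exact: continuous_horner.
Qed.

(* All weighted norms in the energy identity are integrals of polynomials: since
   every u in V_N is divisible by (1 - x)^2, the singular weights cancel. *)
Definition pint p : R := \int[mu]_(x in itvI) p.[x].

Lemma pint_linear : linear_for *%R pint.
Proof.
have mI : measurable (itvI : set R) by exact: measurable_itv.
move=> c p q; rewrite /pint -RintegralZl//; last exact: integrable_horner.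
rewrite -RintegralD//; last exact: integrable_horner.
  by apply: eq_Rintegral => x _; rewrite hornerD hornerZ.
have := integrable_horner (c *: p); congr (_.-integrable _ _).
by apply/funext => x /=; rewrite hornerZ.
Qed.

HB.instance Definition _ := GRing.isLinear.Build R {poly R} R _ pint pint_linear.

Lemma pint_ge0 p : (forall x, -1 < x < 1 -> 0 <= p.[x]) -> 0 <= pint p.
Proof.
by move=> p0; apply: Rintegral_ge0 => x; rewrite /itvI/= in_itv => /p0.
Qed.

Lemma pint_deriv p : pint p^`() = p.[1] - p.[-1].
Proof.
rewrite /pint /Rintegral -(@integral_itv_bndoo _ _ _ _ true false); last first.
  by case/integrableP: (integrable_horner p^`()).
rewrite (@continuous_FTC2 _ _ (horner p))//.
- exact: continuous_horner_within.
- exact: derivable_oo_LRcontinuous_horner.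
- by move=> x _; rewrite -derivE.
Qed.

Lemma poly_eq0_itvI p : (forall x, -1 < x < 1 -> p.[x] = 0) -> p = 0.
Proof.
(* The points 1/(i+2), i < [size p], are distinct and lie in I: more roots than a nonzero [p] can
   have. *)
move=> p0; pose rs := [seq (i.+2%:R^-1 : R) | i <- iota 0 (size p)].
apply: (@roots_geq_poly_eq0 _ p rs).
- apply/allP => _ /mapP[i _ ->]; apply/rootP/p0.
  have : 0 < (i.+2%:R : R)^-1 by rewrite invr_gt0 ltr0n.
  have : (i.+2%:R : R)^-1 < 1 by rewrite invf_lt1 ?ltr1n ?ltr0n.
  by move: (_^-1) => y; lra.
- rewrite map_inj_uniq ?iota_uniq// => i j /invr_inj/eqP.
  by rewrite eqr_nat => /eqP[].
- by rewrite size_map size_iota.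
Qed.

Lemma poly_antideriv p : exists q, q^`() = p.
Proof.
exists (\poly_(i < (size p).+1) (p`_i.-1 / i%:R)); apply/polyP => i.
rewrite coef_deriv coef_poly /= ltnS.
case: ltnP => [_|ip]; last by rewrite mul0rn nth_default.
by rewrite -[LHS]mulr_natr mulfVK// pnatr_eq0.
Qed.

Lemma horner_nondecreasing p : (forall x, -1 < x < 1 -> 0 <= p^`().[x]) ->
  forall x, -1 < x < 1 -> p.[-1] <= p.[x] <= p.[1].
Proof.
move=> dp x /andP[x1 x2].
have le_p : {in `[-1, 1] &, {homo horner p : y z / y <= z}}.
  apply: ger0_derive1_le_cc; [by move=> y _; exact: derivable_horner | |].
    by move=> y; rewrite in_itv/= -derivE; exact: dp.
  exact: continuous_horner_within.
by rewrite !le_p// ?in_itv/= ?lexx ?ltW//; lra.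
Qed.

Lemma horner_cst_itvI p : (forall x, -1 < x < 1 -> 0 <= p^`().[x]) ->
  p.[-1] = p.[1] -> p = (p.[1])%:P.
Proof.
move=> dp p11; apply/eqP; rewrite -subr_eq0; apply/eqP/poly_eq0_itvI => x x1.
have := horner_nondecreasing dp x1.
by rewrite hornerD hornerN hornerC p11; lra.
Qed.

(** An antiderivative of [p ^+ 2] is nondecreasing with equal values at -1 and 1, hence constant; no
    almost-everywhere argument is involved. *)
Lemma pint_sqr_eq0 p : pint (p ^+ 2) = 0 -> p = 0.
Proof.
have [q dq] := poly_antideriv (p ^+ 2).
rewrite -dq pint_deriv => /eqP; rewrite subr_eq0 => /eqP q11.
have : q = (q.[1])%:P.
  by apply: horner_cst_itvI => // x _; rewrite dq horner_exp sqr_ge0.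
move=> /(congr1 (@deriv R)); rewrite derivC dq => /eqP.
by rewrite sqrf_eq0 => /eqP.
Qed.

(** * Polynomials in the weighted and Sobolev spaces, and the dual norm *)

Lemma ip_horner p q : ip (horner p) (horner q) = pint (p * q).
Proof. by apply: eq_Rintegral => x _; rewrite mulr1 hornerM. Qed.

(** The pointwise identity is asked only inside I, where the weights singular at 1 are finite; the
    sign of [p] lets squaring undo [Num.sqrt]. *)
Lemma wnorm_sqr w g p : (forall x, -1 < x < 1 -> 0 <= p.[x]) ->
  (forall x, -1 < x < 1 -> g x ^+ 2 * w x = p.[x]) -> wnorm w g ^+ 2 = pint p.
Proof.
move=> p0 gp; have -> : pint p = wip w g g.
  by apply: eq_Rintegral => x; rewrite inE/= /itvI/= in_itv/= => /gp <-; rewrite expr2.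
rewrite sqr_sqrtr//; apply: Rintegral_ge0 => x; rewrite /itvI/= in_itv/= => x1.
by rewrite -expr2 gp// p0.
Qed.

Lemma norm2_horner_sqr p : norm2 (horner p) ^+ 2 = pint (p ^+ 2).
Proof.
by apply: wnorm_sqr => x _; rewrite horner_exp ?sqr_ge0// mulr1.
Qed.

Lemma inL2_horner p : inL2 (horner p).
Proof.
split; first by case/integrableP: (integrable_horner p) => /measurable_EFinP.
have := integrable_horner (p ^+ 2); congr (_.-integrable _ _).
by apply/funext => x /=; rewrite horner_exp.
Qed.

Lemma weak_derivative_horner p : weak_derivative (horner p) (horner p^`()).
Proof.
move=> phi [dphi [a [b [a1 b1 phi0]]]].
have cphi : continuous phi.
  by move=> x; exact/differentiable_continuous/derivable1_diffP/(dphi 0%N).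
have cdphi : continuous (phi^`())%classic.
  by move=> x; exact/differentiable_continuous/derivable1_diffP/(dphi 1%N).
(* Integration by parts is over the closed interval while [ip] is over the open one; the endpoints
   are a null set. *)
have ipE (q : {poly R}) (h : R -> R) : continuous h ->
    ip (horner q) h = \int[mu]_(x in `[-1, 1]) (q.[x] * h x).
  move=> ch; rewrite /ip /wip.
  under eq_Rintegral do rewrite mulr1.
  rewrite /Rintegral -(@integral_itv_bndoo _ _ _ _ true false)//.
  have : mu.-integrable itvI (EFin \o (fun x => q.[x] * h x)).
    apply: continuous_integrable_itvI; apply: continuous_subspaceT => x.
    by apply: cvgM; [exact: continuous_horner | exact: ch].
  by case/integrableP.
rewrite !ipE// (@Rintegration_by_parts _ _ phi (horner p^`()))//.
- have -> : phi 1 = 0 by apply: phi0; rewrite in_itv/=; lra.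
  have -> : phi (-1) = 0 by apply: phi0; rewrite in_itv/=; lra.
  by rewrite !mulr0 subrr sub0r.
- exact: continuous_horner_within.
- exact: derivable_oo_LRcontinuous_horner.
- by move=> x _; rewrite -derivE.
- exact: continuous_subspaceT.
- split=> [x _||]; first exact: (dphi 0%N).
  + by apply: cvg_at_right_filter; exact: cphi.
  + by apply: cvg_at_left_filter; exact: cphi.
Qed.

Lemma inH10_horner p : p.[-1] = 0 -> p.[1] = 0 -> inH10 (horner p).
Proof.
move=> pN1 p1; split => //; last exact: continuous_horner_within.
split; first exact: inL2_horner.
by exists (horner p^`()); [exact: inL2_horner | exact: weak_derivative_horner].
Qed.

Lemma inH210_horner p : inH210 (horner p) ->
  exists2 s, p = (1 - 'X) ^+ 2 * s & s.[-1] = 0.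
Proof.
move=> [_ [_ _ pN1 p1]].
have /factor_theorem[q pE] : root p 1 by exact/rootP.
rewrite p1 => lim0.
(* To the left of 1 the difference quotient in [inH210] equals [q], so its limit 0 is q(1), and 1 is
   a double root of [p]. *)
have /factor_theorem[s qE] : root q 1.
  apply/rootP; apply: (cvg_unique _ _ lim0) => //.
  apply: cvg_trans (cvg_at_left_filter (@continuous_horner _ q 1)).
  apply: near_eq_cvg; near=> x.
  rewrite pE !hornerE subr0 mulfK// subr_eq0 lt_eqF//.
exists s; first by rewrite pE qE; ring.
by move: pN1; rewrite pE qE !hornerE => ?; lra.
Unshelve. all: end_near. Qed.

Lemma ip_le_Hm1_norm g p (r : R) : p.[-1] = 0 -> p.[1] = 0 ->
  Hm1_norm g = r%:E -> ip g (horner p) <= r * norm2 (horner p^`()).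
Proof.
(* The supremum ranges over nonzero functions, so the zero polynomial is treated apart. *)
move=> pN1 p1 gr; have [->|p_neq0] := eqVneq p 0.
  rewrite /ip /wip (@eq_Rintegral _ _ _ _ _ (cst 0)); last first.
    by move=> x _; rewrite horner0 mulr0 mul0r.
  rewrite Rintegral_cst ?mul0r; last exact: measurable_itv.
  have /eqP := norm2_horner_sqr (0 : {poly R})^`().
  by rewrite deriv0 expr0n linear0 sqrf_eq0 => /eqP ->; rewrite mulr0.
(* If the derivative had norm zero, [p] would be constant, hence 0 by its boundary values. *)
have dp_gt0 : 0 < norm2 (horner p^`()).
  rewrite lt_neqAle sqrtr_ge0 andbT eq_sym; apply: contra p_neq0 => /eqP dp0.
  have dpE : p^`() = 0.
    by apply: pint_sqr_eq0; rewrite -norm2_horner_sqr dp0 expr0n.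
  rewrite (@horner_cst_itvI p) ?p1 ?polyC0// dpE => x _.
  by rewrite horner0.
rewrite -ler_pdivrMr// -lee_fin -gr.
apply: (@le_trans _ _ (`|ip g (horner p)| / norm2 (horner p^`()))%:E).
  by rewrite lee_fin ler_pM2r ?invr_gt0// ler_norm.
apply: ereal_sup_ubound; exists (horner p), (horner p^`()); split => //.
- exact: inH10_horner.
- apply: contrapT => p0; move/eqP: p_neq0; apply; apply: poly_eq0_itvI => x x1.
  apply: contrapT => px; apply: p0; exists x; first by rewrite /itvI/= in_itv.
  exact/eqP.
- by split; [exact: inL2_horner | exact: weak_derivative_horner].
Qed.

(* Unlike [hornerE], this leaves the associativity of sums and products alone. *)
Let horner_evalE :=
  (horner_exp, hornerD, hornerN, hornerM, hornerMn, hornerZ, hornerC, hornerX).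

(* Integer multiples keep the polynomial identity within reach of [ring]. *)
Lemma pint_by_deriv m n p q s : p *+ m = q *+ n + s^`() ->
  pint p *+ m = pint q *+ n + (s.[1] - s.[-1]).
Proof.
by move=> /(congr1 pint); rewrite linearD /= !linearMn /= pint_deriv.
Qed.

(** * Integration by parts for p = (1 - x) v *)

Lemma deriv_weightM v : ((1 - 'X) * v)^`() = (1 - 'X) * v^`() - v.
Proof. by rewrite derivM derivB derivX derivC; ring. Qed.

Lemma deriv2_weightM v :
  ((1 - 'X) * v)^`(2) = (1 - 'X) * v^`()^`() - v^`() *+ 2.
Proof. by rewrite derivnS derivn1 !(deriv_weightM, derivB); ring. Qed.

Lemma deriv3_weightM v :
  ((1 - 'X) * v)^`(3) = (1 - 'X) * v^`()^`()^`() - v^`()^`() *+ 3.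
Proof.
by rewrite derivnS deriv2_weightM derivB deriv_weightM derivMn; ring.
Qed.

Lemma pint_deriv3_weightM v : v.[-1] = 0 -> v.[1] = 0 ->
  pint (((1 - 'X) * v)^`(3) * v) =
  3 / 2 * pint (v^`() ^+ 2) + ((1 - 'X) * v)^`().[-1] ^+ 2 / 4.
Proof.
(* The antiderivative is 2 p'' v - (1 - x) v'^2. It vanishes at 1 and equals -2 v'(-1)^2 at -1,
   where p'(-1) = 2 v'(-1). *)
move=> vN1 v1; have := @pint_by_deriv 2 3 (((1 - 'X) * v)^`(3) * v)
  (v^`() ^+ 2) (((1 - 'X) * v)^`(2) * v *+ 2 - (1 - 'X) * v^`() ^+ 2).
rewrite deriv3_weightM deriv2_weightM deriv_weightM !horner_evalE vN1 v1.
move=> H; apply: (mulIf (_ : 2 != 0 :> R)); rewrite ?pnatr_eq0// !mulr_natr H.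
  by field.
rewrite !(derivB, deriv_weightM, derivMn, derivM, expr2).
ring.
Qed.

(** As p' = (1 - x) v' - v, the sum 2 p'' v + 2 (1 - x) v'^2 is the derivative of 2 p' v + v^2,
    which vanishes at both ends. *)
Lemma pint_deriv2_weightM v : v.[-1] = 0 -> v.[1] = 0 ->
  pint (((1 - 'X) * v)^`(2) * v) = - pint ((1 - 'X) * v^`() ^+ 2).
Proof.
move=> vN1 v1; rewrite -(linearN pint).
have := @pint_by_deriv 2 2 (((1 - 'X) * v)^`(2) * v)
  (- ((1 - 'X) * v^`() ^+ 2)) (((1 - 'X) * v)^`() * v *+ 2 + v ^+ 2).
rewrite deriv2_weightM deriv_weightM !horner_evalE vN1 v1.
move=> H; apply: (mulIf (_ : 2 != 0 :> R)); rewrite ?pnatr_eq0// !mulr_natr H.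
  ring.
rewrite !(derivD, derivB, deriv_weightM, derivMn, derivM, expr2).
ring.
Qed.

Lemma pint_deriv_weightM_sqr v : v.[-1] = 0 -> v.[1] = 0 ->
  pint (((1 - 'X) * v)^`() ^+ 2) <= 4 * pint (v^`() ^+ 2).
Proof.
move=> vN1 v1.
(* The two integrands differ by the derivative of (1 - x) v^2, which is zero at both ends. *)
have -> : pint (((1 - 'X) * v)^`() ^+ 2) = pint ((1 - 'X) ^+ 2 * v^`() ^+ 2).
  have := @pint_by_deriv 1 1 (((1 - 'X) * v)^`() ^+ 2)
    ((1 - 'X) ^+ 2 * v^`() ^+ 2) (- ((1 - 'X) * v ^+ 2)).
  rewrite deriv_weightM !mulr1n => ->; first by rewrite !horner_evalE vN1 v1; ring.
  by rewrite derivN deriv_weightM !(derivM, expr2); ring.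
rewrite -subr_ge0 -linearZ -linearB /=; apply: pint_ge0 => x x1.
rewrite !horner_evalE.
have := sqr_ge0 (v^`().[x]); move: (v^`().[x] ^+ 2) => y y0.
have -> : 4 * y - (1 - x) ^+ 2 * y = (1 + x) * (3 - x) * y by ring.
by rewrite !mulr_ge0//; lra.
Qed.

Lemma weight_ge0 p : (forall x, -1 < x < 1 -> 0 <= ((1 - 'X) * p ^+ 2).[x]).
Proof.
move=> x x1; rewrite !horner_evalE mulr_ge0 ?sqr_ge0//; lra.
Qed.

(** * Singular weighted norms as polynomial integrals *)

Lemma wnorm_jacobiN1_weightM v :
  wnorm (jacobi (-1) 0) (horner ((1 - 'X) * v)) ^+ 2 = pint ((1 - 'X) * v ^+ 2).
Proof.
apply: wnorm_sqr; first exact: weight_ge0.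
move=> x x1; rewrite /jacobi powRr0 mulr1 powR_inv1; last by lra.
by rewrite !horner_evalE; field; lra.
Qed.

Lemma wnorm_jacobiN3_weight2M s :
  wnorm (jacobi (-3) 0) (horner ((1 - 'X) ^+ 2 * s)) ^+ 2
  = pint ((1 - 'X) * s ^+ 2).
Proof.
apply: wnorm_sqr; first exact: weight_ge0.
move=> x x1; rewrite /jacobi powRr0 mulr1.
have -> : (1 - x) `^ (-3) = (1 - x) ^- 3 by rewrite powRN powR_mulrn//; lra.
by rewrite !horner_evalE; field; lra.
Qed.

(** Here p' = (1 - x) (v' - s), so the difference of integrands is (1 - x) v'^2 - 2 (1 - x) s v'. As
    (1 - x) s = v, the last term is -(v^2)', which integrates to zero. *)
Lemma wnorm_deriv_sub s : let p := (1 - 'X) ^+ 2 * s in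
  let v := (1 - 'X) * s in s.[-1] = 0 ->
  wnorm (jacobi (-1) 0) (horner p^`()) ^+ 2 - wnorm (jacobi (-3) 0) (horner p) ^+ 2
  = pint ((1 - 'X) * v^`() ^+ 2).
Proof.
move=> p v sN1; rewrite wnorm_jacobiN3_weight2M.
have -> : p^`() = (1 - 'X) * (v^`() - s).
  by rewrite /p expr2 -mulrA !deriv_weightM /v; ring.
have vE : v = (1 - 'X) * s by [].
move: v vE => v vE; rewrite wnorm_jacobiN1_weightM -linearB /=.
have := @pint_by_deriv 1 1 ((1 - 'X) * (v^`() - s) ^+ 2 - (1 - 'X) * s ^+ 2)
    ((1 - 'X) * v^`() ^+ 2) (- v ^+ 2).
rewrite !mulr1n => ->; first by rewrite vE !horner_evalE sN1; ring.
by rewrite derivN !expr2 derivM; move: v^`() => dv; rewrite vE; ring.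
Qed.

End PolynomialIntegrals.

(** * Young's inequality in a single time step *)

(** The energy inequality is multiplied by 8 ell. The square 8 (X - ell r)^2 absorbs the source and
    uses 8 X^2 of the available 24 ell al X^2. The remaining 8 (3 ell al - 1) X^2 dominates the [P]
    term, as P <= 4 X^2 and 3 ell al >= 1. *)
Lemma energy_step_alpha_bounded (F : realFieldType)
    (E0 E1 dt al be X P B D r ell : F) :
  0 < dt -> 0 <= al -> 0 <= be -> 0 <= B -> 0 <= D -> P <= 4 * X ^+ 2 ->
  E1 - E0 + 2 * dt * (al * (3 / 2 * X ^+ 2 + B / 4) + be * D)
    <= 2 * dt * (r * X) ->
  1 <= ell -> 1 / (3 * ell) <= al ->
  8 * ell * E1 + dt * ((3 * ell * al - 1) * P + al * B + be * D)
  <= 8 * ell * E0 + 8 * dt * ell ^+ 2 * r ^+ 2.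
Proof.
move=> dt_gt0 al_ge0 be_ge0 B_ge0 D_ge0 P_le energy ell_ge1.
rewrite ler_pdivrMr; last by lra.
move=> al_ge.
have energy_ell := ler_wpM2l (_ : 0 <= 8 * ell) energy.
have {}energy_ell := energy_ell ltac:(lra).
suff : dt * ((3 * ell * al - 1) * P + al * B + be * D) <=
    dt * (24 * ell * al * X ^+ 2 + 4 * ell * (al * B) + 16 * ell * (be * D)
          - 16 * ell * r * X + 8 * ell ^+ 2 * r ^+ 2) by lra.
apply: ler_wpM2l; first exact: ltW.
have young : 0 <= (X - ell * r) ^+ 2 := sqr_ge0 _.
have : 0 <= (3 * ell * al - 1) * (8 * X ^+ 2 - P).
  have X2_ge0 : 0 <= X ^+ 2 := sqr_ge0 X.
  by rewrite mulr_ge0//; lra.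
have : 0 <= (4 * ell - 1) * (al * B) by rewrite !mulr_ge0//; lra.
have : 0 <= (16 * ell - 1) * (be * D) by rewrite !mulr_ge0//; lra.
by lra.
Qed.

(** With the factor 4, the square 4 al (X - r / al)^2 uses 4 al X^2 out of 12 al X^2, and the
    remaining 8 al X^2 dominates al P. *)
Lemma energy_step_alpha_pos (F : realFieldType)
    (E0 E1 dt al be X P B D r : F) :
  0 < dt -> 0 < al -> 0 <= be -> 0 <= B -> 0 <= D -> P <= 4 * X ^+ 2 ->
  E1 - E0 + 2 * dt * (al * (3 / 2 * X ^+ 2 + B / 4) + be * D)
    <= 2 * dt * (r * X) ->
  4 * E1 + dt * (al * P + al * B + be * D)
  <= 4 * E0 + 4 * dt * (1 / al) * r ^+ 2.
Proof.
move=> dt_gt0 al_gt0 be_ge0 B_ge0 D_ge0 P_le energy.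
have al_ge0 := ltW al_gt0.
suff : dt * (al * P + al * B + be * D) <=
    dt * (12 * al * X ^+ 2 + 2 * (al * B) + 8 * (be * D)
          - 8 * r * X + 4 * (1 / al) * r ^+ 2) by lra.
apply: ler_wpM2l; first exact: ltW.
have young : 0 <= al * (X - r / al) ^+ 2 by rewrite mulr_ge0 ?sqr_ge0.
have youngE : al * (X - r / al) ^+ 2 = al * X ^+ 2 - 2 * r * X + (1 / al) * r ^+ 2.
  by field; rewrite gt_eqF.
have : 0 <= al * (4 * X ^+ 2 - P) by rewrite mulr_ge0//; lra.
have : 0 <= al * B by rewrite mulr_ge0.
have : 0 <= be * D by rewrite mulr_ge0.
have : 0 <= al * X ^+ 2 by rewrite mulr_ge0 ?sqr_ge0.
by lra.
Qed.

(** * Extended-real summation and the discrete energy inequality *)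

Section DiscreteEnergy.
Context {R : realType}.

(* If the dual norm x is infinite, so is the right-hand side. *)
Lemma ereal_le_expe2 (a b c : R) (x : \bar R) : 0 < c ->
  (forall r : R, x = r%:E -> a <= b + c * r ^+ 2) ->
  (a%:E <= b%:E + c%:E * x ^+ 2)%E.
Proof.
move=> c_gt0; case: x => [r|_|_]; last 2 first.
- by rewrite expe2 mulyy gt0_muley ?lte_fin// addey// leey.
- by rewrite expe2 mulNyNy gt0_muley ?lte_fin// addey// leey.
by move=> /(_ r erefl); rewrite -EFin_expe -EFinM -EFinD lee_fin.
Qed.

(** Nonnegativity of [G] lets [C] distribute over a sum whose terms may be infinite. *)
Lemma ereal_telescope (E s : nat -> R) (C : R) (G : nat -> \bar R) (n : nat) :
  (forall k, (k < n)%N -> (0 <= G k)%E) ->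
  (forall k, (k < n)%N ->
     ((E k.+1 + s k)%:E <= (E k)%:E + C%:E * G k)%E) ->
  ((E n + \sum_(0 <= k < n) s k)%:E <=
   (E 0%N)%:E + C%:E * \sum_(0 <= k < n) G k)%E.
Proof.
elim: n => [|n IHn] G_ge0 step; first by rewrite !big_geq// mule0 adde0 addr0.
have {}IHn := IHn (fun k kn => G_ge0 k (ltnW kn)) (fun k kn => step k (ltnW kn)).
have sum_ge0 : (0 <= \sum_(0 <= k < n) G k)%E.
  rewrite big_nat_cond; apply: sume_ge0 => k; rewrite andbT => /andP[_ kn].
  exact/G_ge0/ltnW.
rewrite !big_nat_recr//= ge0_muleDr ?G_ge0// addeA.
apply: le_trans (leeD2r _ IHn).
set S := \sum_(0 <= k < n) s k.
have -> : (E n.+1 + (S + s n))%:E = ((E n.+1 + s n)%:E + S%:E)%E.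
  by rewrite -EFinD; congr EFin; ring.
rewrite [X in (_ <= X + _)%E]EFinD addeAC.
exact/leeD2r/step.
Qed.

(* X is the norm of v', where v = p / (1 - x). *)
Lemma LPG_energy_step (N nT k : nat) (dt : R) (alpha beta : R -> R)
    (f : R -> R -> R) (u0 : R -> R) (u : nat -> {poly R}) (r : R) :
  (0 < N)%N -> 0 < dt -> LPG N nT dt alpha beta f u0 u -> (k < nT)%N ->
  Hm1_norm (fhalf f dt k) = r%:E ->
  let p := half u k in
  let E j := wnorm (jacobi (-1) 0) (horner (u j)) ^+ 2 in
  let D := wnorm (jacobi (-1) 0) (horner p^`()) ^+ 2
           - wnorm (jacobi (-3) 0) (horner p) ^+ 2 in
  exists X : R, [/\ 0 <= D, norm2 (horner p^`()) ^+ 2 <= 4 * X ^+ 2 &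
    E k.+1 - E k + 2 * dt * (alpha (tk dt k) *
        (3 / 2 * X ^+ 2 + `|p^`().[-1]| ^+ 2 / 4) + beta (tk dt k) * D)
    <= 2 * dt * (r * X)].
Proof.
move=> N_gt0 dt_gt0 [uV _ scheme] knT Hr p E D.
have [uk_size /inH210_horner[s0 u0E s0N1]] := uV k (ltnW knT).
have [uk1_size /inH210_horner[s1 u1E s1N1]] := uV k.+1 knT.
(* Averaging the cofactors of the two iterates factors the midpoint [p], so v = p / (1 - x) is a
   polynomial. *)
pose s := 2^-1 *: (s1 + s0); pose v := (1 - 'X) * s.
have sN1 : s.[-1] = 0 by rewrite hornerZ hornerD s0N1 s1N1 addr0 mulr0.
have pE2 : p = (1 - 'X) ^+ 2 * s.
  by rewrite /p /half u0E u1E /s -scalerAr mulrDr.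
have pE : p = (1 - 'X) * v by rewrite pE2 /v expr2 mulrA.
have vN1 : v.[-1] = 0 by rewrite hornerM sN1 mulr0.
have v1 : v.[1] = 0 by rewrite hornerM hornerD hornerN hornerC hornerX subrr mul0r.
(* Dividing by 1 - x lowers the degree by one, which puts [v] in the smaller test space. *)
have v_size : (size v <= N)%N.
  have [->|v_neq0] := eqVneq v 0; first by rewrite size_poly0.
  have : (size p <= N.+1)%N.
    rewrite (leq_trans (size_scale_leq _ _))// (leq_trans (size_polyD _ _))//.
    by rewrite geq_max uk_size uk1_size.
  have -> : p = - (v * ('X - 1%:P)) by rewrite pE polyC1; ring.
  by rewrite size_polyN size_Mmonic ?monicXsubC// size_XsubC addn2.
have vW : WN N.-1 v by split; [rewrite /PN prednK|exact: inH10_horner].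
have := scheme k knT v vW; rewrite -/p.
have := ip_le_Hm1_norm vN1 v1 Hr.
rewrite !ip_horner pE pint_deriv3_weightM// pint_deriv2_weightM//.
have DE : D = pint ((1 - 'X) * v^`() ^+ 2) by rewrite /D pE2 wnorm_deriv_sub.
(* The midpoint in [v] turns the product into half a difference of squares. *)
have -> : pint ((u k.+1 - u k) * v) = (E k.+1 - E k) / 2.
  rewrite /E u0E u1E expr2 -!mulrA !wnorm_jacobiN1_weightM -linearB /=.
  rewrite [RHS]mulrC -linearZ /=; congr pint; rewrite /v /s.
  by rewrite -!scalerAr; congr (_ *: _); ring.
rewrite -DE -pE -norm2_horner_sqr => ip_le schemeE.
exists (norm2 (horner v^`())); split.
- by rewrite DE; apply/pint_ge0/weight_ge0.
- by rewrite !norm2_horner_sqr pE pint_deriv_weightM_sqr.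
rewrite real_normK ?num_real//.
(* The left-hand side is exactly 2 dt times the tested scheme, so only the source term is
   estimated. *)
apply: le_trans (ler_wpM2l _ ip_le); last by rewrite mulr_ge0// ltW.
rewrite -schemeE le_eqVlt; apply/orP; left; apply/eqP; field.
by rewrite gt_eqF.
Qed.

End DiscreteEnergy.

(** * The two stability estimates *)

Theorem theorem2p1 (R : realType) (T : R) (N nT : nat) (dt : R)
    (alpha beta : R -> R) (f : R -> R -> R) (u0 : R -> R)
    (u : nat -> {poly R})
    (hT : 0 < T) (hN : (3 <= N)%N) (hdt : 0 < dt) (hnT : nT%:R * dt = T)
    (hf : forall k : nat, (k <= nT)%N -> pairs_with_H10 (at_step f dt k))
    (hu0 : pairs_with_H10 u0)
    (hu : LPG N nT dt alpha beta f u0 u) :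
  (forall ell : R, 1 <= ell ->
    (forall t : R, 0 <= t <= T -> 0 <= beta t /\ 1 / (3 * ell) <= alpha t) ->
    forall n : nat, (0 < n <= nT)%N ->
    ((wnorm (jacobi (-1) 0) (horner (u n)) ^+ 2
      + dt * \sum_(0 <= k < n)
               (3 * ell * alpha (tk dt k) - 1) * norm2 (horner (half u k)^`()) ^+ 2
      + dt * \sum_(0 <= k < n)
               alpha (tk dt k) * `|(half u k)^`().[-1]| ^+ 2
      + dt * \sum_(0 <= k < n)
               beta (tk dt k) *
               (wnorm (jacobi (-1) 0) (horner (half u k)^`()) ^+ 2
                - wnorm (jacobi (-3) 0) (horner (half u k)) ^+ 2))%:E
     <= (8 * ell * wnorm (jacobi (-1) 0) (horner (u 0%N)) ^+ 2)%:E
        + (8 * dt * ell ^+ 2)%:E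
          * \sum_(0 <= k < n) Hm1_norm (fhalf f dt k) ^+ 2)%E)
  /\
  ((forall t : R, 0 <= t <= T -> 0 < beta t /\ 0 < alpha t) ->
    forall n : nat, (0 < n <= nT)%N ->
    ((wnorm (jacobi (-1) 0) (horner (u n)) ^+ 2
      + dt * \sum_(0 <= k < n)
               alpha (tk dt k) * norm2 (horner (half u k)^`()) ^+ 2
      + dt * \sum_(0 <= k < n)
               alpha (tk dt k) * `|(half u k)^`().[-1]| ^+ 2
      + dt * \sum_(0 <= k < n)
               beta (tk dt k) *
               (wnorm (jacobi (-1) 0) (horner (half u k)^`()) ^+ 2
                - wnorm (jacobi (-3) 0) (horner (half u k)) ^+ 2))%:E
     <= (4 * wnorm (jacobi (-1) 0) (horner (u 0%N)) ^+ 2)%:E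
        + (4 * dt)%:E
          * \sum_(0 <= k < n)
              ((1 / alpha (tk dt k))%:E * Hm1_norm (fhalf f dt k) ^+ 2))%E).
Proof.
have kT (n k : nat) : (n <= nT)%N -> (k < n)%N -> 0 <= tk dt k <= T.
  move=> nT_ge kn; rewrite /tk -hnT mulr_ge0 ?(ltW hdt)//=.
  by rewrite ler_pM2r// ler_nat (leq_trans (ltnW kn)).
have N_gt0 : (0 < N)%N by apply: leq_trans hN.
have Hm2_ge0 k : (0 <= Hm1_norm (fhalf f dt k) ^+ 2)%E.
  by case: (Hm1_norm _) => [r||]; rewrite ?expe2 ?mulyy ?mulNyNy ?leey// -EFinM
    lee_fin -expr2 sqr_ge0.
pose dissipation (c : nat -> R) k := dt *
  (c k * norm2 (horner (half u k)^`()) ^+ 2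
   + (alpha (tk dt k) * `|(half u k)^`().[-1]| ^+ 2
      + beta (tk dt k) *
        (wnorm (jacobi (-1) 0) (horner (half u k)^`()) ^+ 2
         - wnorm (jacobi (-3) 0) (horner (half u k)) ^+ 2))).
(* The factor [c] must stand on both energies for the sum to telescope; [E_ge] then lowers it to 1
   at the final time. *)
pose E c k := c * wnorm (jacobi (-1) 0) (horner (u k)) ^+ 2.
have E_ge (c a : R) n : 1 <= c -> E 1 n + a <= E c n + a.
  by move=> c1; rewrite lerD2r ler_wpM2r ?sqr_ge0.
split=> [ell ell_ge1 coef n /andP[_ n_le]|coef n /andP[_ n_le]].
- rewrite -!addrA -!mulrDr -!big_split/= mulr_sumr.
  apply: le_trans (@ereal_telescope _ (E (8 * ell))
    (dissipation (fun k => 3 * ell * alpha (tk dt k) - 1))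
    (8 * dt * ell ^+ 2) _ n _ _).
  + by rewrite lee_fin -[X in X + _]mul1r E_ge//; lra.
  + by move=> k _; exact: Hm2_ge0.
  move=> k kn; rewrite -expe2; apply: ereal_le_expe2 => [|r Hr].
    by rewrite !mulr_gt0 ?exprn_gt0//; lra.
  have [X [D_ge0 P_le energy]] :=
    LPG_energy_step N_gt0 hdt hu (leq_trans kn n_le) Hr.
  have [be_ge0 al_ge] := coef _ (kT _ _ n_le kn).
  have al_ge0 : 0 <= alpha (tk dt k).
    by apply: le_trans al_ge; rewrite divr_ge0//; lra.
  rewrite /dissipation addrA; exact: energy_step_alpha_bounded P_le energy _ _.
- rewrite -!addrA -!mulrDr -!big_split/= mulr_sumr.
  apply: le_trans (@ereal_telescope _ (E 4)
    (dissipation (fun k => alpha (tk dt k))) (4 * dt) _ n _ _).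
  + by rewrite lee_fin -[X in X + _]mul1r E_ge//; lra.
  + move=> k kn; have [_ al_gt0] := coef _ (kT _ _ n_le kn).
    apply: mule_ge0; last exact: Hm2_ge0.
    by rewrite lee_fin divr_ge0// ltW.
  move=> k kn; have [be_gt0 al_gt0] := coef _ (kT _ _ n_le kn).
  (* The factor 1 / alpha varies with [k], so it stays in the telescoped terms and joins the
     constant only within each step. *)
  rewrite -expe2 muleA -EFinM; apply: ereal_le_expe2 => [|r Hr].
    by rewrite !mulr_gt0 ?invr_gt0//; lra.
  have [X [D_ge0 P_le energy]] :=
    LPG_energy_step N_gt0 hdt hu (leq_trans kn n_le) Hr.
  rewrite /dissipation addrA.
  exact: energy_step_alpha_pos al_gt0 (ltW be_gt0) _ _ P_le energy.
Qed.
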